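(* Let $V$ be a finite-dimensional real vector space. A cone $C \subset V$ (that is, a closed pointed convex linear cone) satisfies the centrally symmetric sections (CSS) property, i.e. every bounded section of $C$ is centrally symmetric, if and only if $C$ is an ellipsoidal cone, i.e. some section of $C$ is an ellipsoid.
   Context: A convex linear cone in $V$ is a nonempty convex subset $C \subset V$ such that $a \in C$ and $\lambda \ge 0$ imply $\lambda a \in C$. It is pointed if there exists a hyperplane $H$ in $V$ such that $H \cap C = \{0\}$. ''Cone'' means closed pointed convex linear cone. For a convex subset $K \subset V$, $\dim K$ is the dimension of its affine span. A section of $K$ is a $(\dim K - 1)$-dimensional intersection of $K$ with an affine hyperplane. A (solid) ellipsoid in $V$ is the image of the closed unit ball in some Euclidean vector space $E$ under an affine map $E \to V$. A set $S$ is centrally symmetric if there is a point $c$ with $S = 2c - S$, where $2c - S = \{2c - x : x \in S\}$.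
   Formalization: The cone C is assumed to be different from {0}: in a nonzero V the cone {0} satisfies CSS vacuously (its only possible section is the empty set) but has no section that is an ellipsoid, so the equivalence fails there. *)

(* Defs.v *)
From HB Require Import structures.
From mathcomp Require Import all_boot all_order all_algebra sesquilinear.
From mathcomp Require Import all_classical all_reals all_analysis.

Set Implicit Arguments.
Unset Strict Implicit.
Unset Printing Implicit Defensive.

Import Order.TTheory GRing.Theory Num.Theory.
Import numFieldNormedType.Exports.

Local Open Scope classical_set_scope.
Local Open Scope ring_scope.

(* A vectType carries no topology in the library.  Closedness and boundedness
   refer to the canonical topology of a finite-dimensional real vector space,
   obtained from the coordinate isomorphism v2r : V -> 'rV[R]_(dim V). *)
Definition vclosed (R : realType) (V : vectType R) (A : set V) : Prop :=
  closed (VectorInternalTheory.v2r @` A).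

Definition vbounded (R : realType) (V : vectType R) (A : set V) : Prop :=
  bounded_set (VectorInternalTheory.v2r @` A).

Definition flat (R : realType) (V : vectType R) (p : V) (U : {vspace V}) :
  set V := [set x | x - p \in U].

(* There are no hyperplanes when dim V = 0. *)
Definition linear_hyperplane (R : realType) (V : vectType R)
    (U : {vspace V}) : Prop :=
  (\dim U).+1 = \dim {:V}.

Definition affine_hyperplane (R : realType) (V : vectType R) (H : set V) :
  Prop := exists (p : V) (U : {vspace V}), linear_hyperplane U /\ H = flat p U.

Definition affine_span (R : realType) (V : vectType R) (K : set V) : set V :=
  [set x | exists (n : nat) (a : 'I_n -> R) (k : 'I_n -> V),
    [/\ forall i, K (k i),
        \sum_(i < n) a i = 1 &
        x = \sum_(i < n) a i *: k i] ].

(* has_dim K d means dim K = d, the dimension of the affine span of K; the empty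
   set has no dimension. *)
Definition has_dim (R : realType) (V : vectType R) (K : set V) (d : nat) :
  Prop := exists (p : V) (U : {vspace V}),
    affine_span K = flat p U /\ \dim U = d.

Definition is_section (R : realType) (V : vectType R) (K S : set V) : Prop :=
  exists (H : set V) (d : nat),
    [/\ affine_hyperplane H, S = K `&` H, has_dim K d.+1 & has_dim S d].

Definition pointed (R : realType) (V : vectType R) (C : set V) : Prop :=
  exists U : {vspace V}, linear_hyperplane U /\ [set` U] `&` C = [set 0].

Definition convex_linear_cone (R : realType) (V : vectType R) (C : set V) :
  Prop :=
  [/\ C !=set0, convex_set C &
      forall (a : V) (l : R), C a -> 0 <= l -> C (l *: a)].

Definition is_cone (R : realType) (V : vectType R) (C : set V) : Prop :=
  [/\ convex_linear_cone C, pointed C & vclosed C].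

Definition centrally_symmetric (R : realType) (V : vectType R) (S : set V) :
  Prop := exists c : V, S = [set c *+ 2 - x | x in S].

(* A Euclidean vector space is a finite-dimensional E with an inner product
   ip : {dot E for idfun} (bilinear, symmetric, positive definite). *)
Definition unit_ball (R : realType) (E : vectType R) (ip : {dot E for idfun}) :
  set E := [set x | Num.sqrt (ip x x) <= 1].

Definition is_ellipsoid (R : realType) (V : vectType R) (S : set V) : Prop :=
  exists (E : vectType R) (ip : {dot E for idfun}) (f : {linear E -> V})
         (p : V),
    S = [set p + f x | x in unit_ball ip].

(* In a nonzero V the cone [set 0] has no section, so it satisfies CSS
   vacuously and is not ellipsoidal: the equivalence of CSS and
   ellipsoidal_cone needs C <> [set 0]. *)
Definition CSS (R : realType) (V : vectType R) (C : set V) : Prop :=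
  forall S : set V, is_section C S -> vbounded S -> centrally_symmetric S.

Definition ellipsoidal_cone (R : realType) (V : vectType R) (C : set V) : Prop :=
  exists S : set V, is_section C S /\ is_ellipsoid S.

(* Main.v *)
Require Import Defs.
From HB Require Import structures.
From mathcomp Require Import all_boot all_order all_algebra sesquilinear.
From mathcomp Require Import all_classical all_reals all_analysis.
From mathcomp Require Import ring lra zify.

Set Implicit Arguments.
Unset Strict Implicit.
Unset Printing Implicit Defensive.

Import Order.TTheory GRing.Theory Num.Theory.
Import numFieldNormedType.Exports.

Local Open Scope classical_set_scope.
Local Open Scope ring_scope.

(* Suppose the bounded sections of [C] are centrally symmetric. If [f] is positive
   on [C] minus the origin and [c] is the center of the section [f = 1], then the
   linear reflection [x |-> 2 f(x) c - x] preserves [C].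

   Fix such [f] and [c], a boundary point [u] of the section [f = 1], a linear
   form [b >= 0] on [C] with [b u = 0] and [b c = 1/2], and the point
   [v = 2 c - u]. Composing the reflections attached to [f] and to the form
   [l (f - b) + b], [l > 0], gives an automorphism of [C] which is the identity on
   [K = ker f `&` ker b]. It turns out to be the Lorentz boost [u |-> u / l],
   [v |-> l v]: an a priori translation part along [K] is excluded because it
   would make the face of [C] at [u] unbounded. With [w = u - c], these boosts
   show that [r c + a w + k] with [k] in [K] belongs to [C] if and only if
   [|a| <= r] and [sqrt (r^2 - a^2) c + k] does. In other words, the norm with
   unit ball [(C `&` f = 1) - c] satisfies Pythagoras for the decomposition
   [R w + K], and induction on the dimension produces Euclidean coordinates.

   Conversely, a cone with an ellipsoidal section is a linear image of a Lorentz
   cone, and the sections of the latter are symmetric by Lorentz reflections. *)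

(** * Linear forms, their kernels, and separation of points *)

Section Functionals.
Variables (R : realType) (V : vectType R).
Implicit Types (f g : {scalar V}) (U : {vspace V}).

Lemma scalarD f x y : f (x + y) = f x + f y. Proof. exact: linearD. Qed.
Lemma scalarN f x : f (- x) = - f x. Proof. exact: linearN. Qed.
Lemma scalarZ f a x : f (a *: x) = a * f x. Proof. exact: linearZ. Qed.
Lemma scalar0 f : f 0 = 0. Proof. exact: linear0. Qed.

Definition scalarE f := (scalarD f, scalarN f, scalarZ f, scalar0 f).

Definition scomb (s t : R) f g (x : V) : R := s * f x + t * g x.

Fact scomb_is_scalar s t f g : scalar (scomb s t f g).
Proof. by move=> a x y; rewrite /scomb !linearP /=; ring. Qed.

HB.instance Definition _ s t f g :=
  GRing.isLinear.Build R V R *%R (scomb s t f g) (scomb_is_scalar s t f g).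

Lemma scalar_of_linear (f : {linear V -> R^o}) : {g : {scalar V} | g =1 f}.
Proof.
have fs : scalar (f : V -> R) by move=> a x y; rewrite linearP.
pose F := GRing.isLinear.Build R V R *%R (f : V -> R) fs.
pose g : {scalar V} := HB.pack (f : V -> R) F.
by exists g.
Qed.

(** Retargeting to [R^o] makes a form a map between vector types, to which [linfun] and [lker]
    apply. *)
Lemma linear_of_scalar f : {g : {linear V -> R^o} | g =1 f}.
Proof.
have fs : linear (f : V -> R^o) by move=> a x y; rewrite linearP.
pose F := GRing.isLinear.Build R V R^o *:%R (f : V -> R^o) fs.
pose g : {linear V -> R^o} := HB.pack (f : V -> R^o) F.
by exists g.
Qed.

Definition sker f : {vspace V} := lker (linfun (sval (linear_of_scalar f))).

Lemma mem_sker f x : (x \in sker f) = (f x == 0).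
Proof. by rewrite memv_ker lfunE /= (svalP (linear_of_scalar f)). Qed.

(** Rank-nullity: the image of [U] under [f] is a nonzero subspace of a line. *)
Lemma dim_cap_sker f U x : x \in U -> f x != 0 ->
  (\dim (U :&: sker f)).+1 = \dim U.
Proof.
move=> xU fx; rewrite -(limg_ker_dim (linfun (sval (linear_of_scalar f))) U).
rewrite -addn1; congr addn; apply/eqP; rewrite eqn_leq; apply/andP; split; last first.
  by apply: leq_trans (dimvS (subvf _)) _; rewrite dimvf.
rewrite lt0n dimv_eq0; apply: contra_neq fx => U0.
have := memv_img (linfun (sval (linear_of_scalar f))) xU.
by rewrite U0 memv0 lfunE /= (svalP (linear_of_scalar f)) => /eqP.
Qed.

(** The family made of [y] and a basis of [U] is free, so the values 1 and 0 can be prescribed on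
    it. *)
Lemma scalar_separation U y : y \notin U ->
  exists f, (forall x, x \in U -> f x = 0) /\ f y = 1.
Proof.
move=> yU; pose X := y :: vbasis U; pose fX : seq R^o := 1 :: nseq (\dim U) 0.
have [h hX] := linear_of_free X fX.
have [g gh] := scalar_of_linear h.
have fr : free X.
  by rewrite free_cons (span_basis (vbasisP U)) yU (basis_free (vbasisP U)).
have [hy hU] : h y = 1 /\ map h (vbasis U) = nseq (\dim U) 0.
  have sX : size fX = size X by rewrite /= size_nseq size_tuple.
  by have [-> ->] := hX fr sX.
exists g; split; last by rewrite gh.
move=> x xU; rewrite gh (coord_vbasis xU) linear_sum big1 // => i _.
rewrite linearZ /=; suff -> : h (vbasis U)`_i = 0 by rewrite scaler0.
by rewrite -(nth_map _ 0 h) ?size_tuple // hU nth_nseq ltn_ord.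
Qed.

Lemma hyperplane_scalar U p : linear_hyperplane U -> p \notin U ->
  exists f, f p = 1 /\ forall x, (x \in U) = (f x == 0).
Proof.
move=> hU pU; have [f [fU fp]] := scalar_separation pU; exists f; split => //.
suff -> : U = sker f by move=> x; rewrite mem_sker.
apply/eqP; rewrite eqEdim; apply/andP; split.
  by apply/subvP => x xU; rewrite mem_sker fU.
rewrite -ltnS hU -(@dim_cap_sker f fullv p) ?memvf ?fp ?oner_eq0 //.
by rewrite capfv.
Qed.

Lemma sker_hyperplane f x : f x != 0 -> linear_hyperplane (sker f).
Proof. by move=> fx; rewrite /linear_hyperplane -(dim_cap_sker (memvf x) fx) capfv. Qed.

Lemma eq_scalar x y : (forall f, f x = f y) -> x = y.
Proof.
move=> exy; apply/eqP; rewrite -subr_eq0; apply/negP => /negP xy.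
have [|f [_]] := @scalar_separation 0%VS (x - y); first by rewrite memv0.
by rewrite linearB /= exy subrr => /eqP; rewrite eq_sym oner_eq0.
Qed.

End Functionals.

(** Tests an identity between vectors against an arbitrary form, which leaves an identity in [R] for
    [ring] or [field]. *)
Ltac vector_ext :=
  let f := fresh "f" in apply: eq_scalar => f; rewrite !(scalarE f).

(** * Convex cones, positive forms and the Riesz extension theorem *)

Definition positive_on (R : realType) (V : vectType R) (C : set V)
  (f : V -> R) := forall x, C x -> x != 0 -> 0 < f x.

Lemma positive_on_ge0 (R : realType) (V : vectType R) (C : set V)
  (f : {scalar V}) x : positive_on C f -> C x -> 0 <= f x.
Proof.
by move=> f_pos Cx; have [->|x0] := eqVneq x 0; rewrite ?scalar0 // ltW // f_pos.
Qed.

Lemma positive_on_kernel (R : realType) (V : vectType R) (C : set V)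
  (f : {scalar V}) x : positive_on C f -> C x -> f x = 0 -> x = 0.
Proof. by move=> f_pos Cx fx; apply: contra_eq fx => /(f_pos _ Cx) /lt0r_neq0. Qed.

(** The only consequence of closedness that the construction of the boosts and of the coordinates
    uses. *)
Definition line_closed (R : realType) (V : vectType R) (C : set V) :=
  forall x y, (forall e : R, 0 < e ->
    exists d : R, [/\ 0 <= d, d < e & C (x + d *: y)]) -> C x.

(** Homogeneous form of central symmetry: on the level [f = 1] the map is the point reflection
    [x |-> 2 c - x]. *)
Definition section_center (R : realType) (V : vectType R) (C : set V)
  (f : V -> R) (c : V) :=
  [/\ C c, f c = 1 & forall x, C x -> C ((2 * f x) *: c - x)].

Section ConvexCone.
Variables (R : realType) (V : vectType R) (C : set V).
Hypothesis C0 : C 0.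
Hypothesis CD : forall x y, C x -> C y -> C (x + y).
Hypothesis CZ : forall x (l : R), C x -> 0 <= l -> C (l *: x).
Implicit Types (f g a b : {scalar V}) (M : {vspace V}).

(** Positivity asks that the value at [y] lie above every [- f m] with [m + y] in [C] and below
    every [f m] with [m - y] in [C]. As [C] is stable under sums, each lower bound is below each
    upper bound, and the supremum of the lower ones is a valid choice. *)
Lemma riesz_extension_step M f c y : c \in M ->
    (forall x, C x -> exists l : R, C (l *: c - x)) ->
    (forall x, x \in M -> C x -> 0 <= f x) -> C y -> y \notin M ->
  exists g, (forall x, x \in M -> g x = f x) /\
    forall x, x \in (M + <[y]>)%VS -> C x -> 0 <= g x.
Proof.
move=> cM unit f0 Cy yM; have [h [hM hy]] := scalar_separation yM.
pose A := [set t | exists m, [/\ m \in M, C (m + y) & t = - f m]].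
have ubA m : m \in M -> C (m - y) -> ubound A (f m).
  move=> mM Cm _ [m' [m'M Cm' ->]]; rewrite lerNl -subr_ge0 opprK addrC -linearD.
  apply: f0; first exact: memvD.
  have -> : m + m' = (m - y) + (m' + y) by vector_ext; ring.
  exact: CD.
have supA : has_sup A.
  split; first by exists (- f 0), 0; rewrite mem0v add0r.
  by have [l Cl] := unit _ Cy; exists (f (l *: c)); apply: ubA Cl; exact: memvZ.
exists (scomb 1 (sup A - f y) f h); split=> [x xM|].
  by rewrite /= /scomb hM // mulr0 addr0 mul1r.
move=> _ /memv_addP[m mM [_ /vlineP[t ->] ->]] Cx.
rewrite /= /scomb 2!linearD 2!linearZ /= hM // hy.
have -> : 1 * (f m + t * f y) + (sup A - f y) * (0 + t * 1) = f m + t * sup A by ring.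
have [t0|t0|t0] := ltgtP t 0.
- have : sup A <= f (- t^-1 *: m).
    apply: ge_sup; first by case: supA.
    apply: ubA; first exact: memvZ.
    have -> : - t^-1 *: m - y = (- t^-1) *: (m + t *: y).
      by vector_ext; field; rewrite lt_eqF.
    by apply: CZ => //; rewrite oppr_ge0 invr_le0 ltW.
  rewrite linearZ /= mulNr -(ler_nM2l t0) mulrN mulrA divff ?lt_eqF // => h1; lra.
- have : - f (t^-1 *: m) <= sup A.
    apply: ub_le_sup; first by case: supA.
    exists (t^-1 *: m); split=> //; first exact: memvZ.
    have -> : t^-1 *: m + y = t^-1 *: (m + t *: y).
      by vector_ext; field; rewrite gt_eqF.
    by apply: CZ => //; rewrite invr_ge0 ltW.
  rewrite linearZ /= -(ler_pM2l t0) mulrN mulrA divff ?gt_eqF // => h1; lra.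
- by rewrite t0 mul0r addr0; apply: f0 => //; move: Cx; rewrite t0 scale0r addr0.
Qed.

(** Vectors of [C] are adjoined to [M] one at a time; the codimension drops, and the process stops
    once [C] lies in [M]. *)
Lemma riesz_extension M f c : c \in M ->
    (forall x, C x -> exists l : R, C (l *: c - x)) ->
    (forall x, x \in M -> C x -> 0 <= f x) ->
  exists g, (forall x, x \in M -> g x = f x) /\ forall x, C x -> 0 <= g x.
Proof.
move=> + unit; have [n] := ubnP (\dim {:V} - \dim M).
elim: n M f => // n IHn M f ltn cM f0.
have [CM|/existsNP[y /not_implyP[Cy /negP yM]]] := pselect (forall x, C x -> x \in M).
  by exists f; split=> // x Cx; apply: f0 => //; exact: CM.
have [g [gf g0]] := riesz_extension_step cM unit f0 Cy yM.
have MM' : (M <= M + <[y]>)%VS by exact: addvSl.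
have [||h [hg h0]] := IHn (M + <[y]>)%VS g _ _ g0.
- have ltM : (\dim M < \dim (M + <[y]>))%N.
    rewrite ltn_neqAle dimvS // andbT; apply: contra yM => /eqP eqd.
    have /eqP -> : M == (M + <[y]>)%VS by rewrite eqEdim MM' eqd leqnn.
    by rewrite (subvP (addvSr _ _)) ?memv_line.
  have := dimvS (subvf (M + <[y]>)%VS); have := dimvS (subvf M).
  by move: ltn ltM; lia.
- exact: (subvP MM').
by exists h; split=> // x xM; rewrite hg ?gf //; exact: (subvP MM').
Qed.

End ConvexCone.

Lemma exists_expr2_lt (R : realType) (e : R) : 0 < e -> exists n, (2 ^+ n)^-1 < e.
Proof.
move=> e0; exists (Num.truncn e^-1).+1.
rewrite -[ltRHS]invrK ltf_pV2 ?posrE ?exprn_gt0 ?invr_gt0 ?ltr0n //.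
apply: lt_trans (truncnS_gt _) _.
by rewrite -natrX ltr_nat ltn_expl.
Qed.

(** * Lorentz boosts from pairs of reflections, and Pythagoras *)

Section Boost.
Variables (R : realType) (V : vectType R) (C : set V).
Hypothesis C0 : C 0.
Hypothesis CZ : forall x (l : R), C x -> 0 <= l -> C (l *: x).
Hypothesis C_line_closed : line_closed C.
Hypothesis C_center :
  forall f : {scalar V}, positive_on C f -> exists c, section_center C f c.
Variables (f b : {scalar V}) (c u v : V).
Hypothesis f_pos : positive_on C f.
Hypothesis c_center : section_center C f c.
Hypothesis b_ge0 : forall x, C x -> 0 <= b x.
Hypothesis Cu : C u.
Hypothesis bu : b u = 0.
Hypothesis fu : f u = 1.
Hypothesis bc : b c = 2^-1.
Hypothesis vE : v = 2 *: c - u.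

Let fbE := (scalarE f, scalarE b).
Let fc : f c = 1. Proof. by case: c_center. Qed.
Let bv : b v = 1.
Proof. by rewrite vE !fbE bu bc subr0 divff ?pnatr_eq0. Qed.
Let fv : f v = 1.
Proof. by rewrite vE !fbE fu fc; lra. Qed.

Let b_le_f x : C x -> b x <= f x.
Proof.
move=> Cx; have [_ _ /(_ _ Cx)] := c_center.
by move/b_ge0; rewrite !fbE bc; lra.
Qed.

Let kernel_cone k : C k -> f k = 0 -> k = 0. Proof. exact: positive_on_kernel. Qed.

(* The map is the reflection in [c] followed by the reflection in the center [d]
   of the section of [l (f - b) + b]. Positivity of [f - b] and [b] on the
   reflections of [u] and [v] in [d] determines [d] modulo
   [ker f `&` ker b]. *)
Lemma twisted_boost l : 0 < l -> exists k, [/\ f k = 0, b k = 0 &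
  forall p q k', f k' = 0 -> b k' = 0 -> C (p *: u + q *: v + k') ->
    C ((p / l) *: u + (q * l) *: v + (k' + (2 * (p + q * l)) *: k))].
Proof.
move=> l0; pose chi : {scalar V} := scomb l (1 - l) f b.
have chiE x : chi x = l * f x + (1 - l) * b x by [].
have chi_pos : positive_on C chi.
  move=> x Cx x0; rewrite chiE; have := f_pos Cx x0; have := b_le_f Cx.
  have := b_ge0 Cx => b0 bf f0.
  have -> : l * f x + (1 - l) * b x = l * (f x - b x) + b x by ring.
  have [->|b0'] := eqVneq (b x) 0; first by rewrite addr0 subr0 mulr_gt0.
  by rewrite ltr_wpDl // ?lt0r ?b0' // mulr_ge0 ?subr_ge0 // ltW.
have [d [Cd chid reflect_d]] := C_center chi_pos.
have Cv : C v by have [_ _ /(_ _ Cu)] := c_center; rewrite fu mulr1 vE.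
have bd : b d = 2^-1 /\ l * f d = 2^-1 + l / 2.
  have := b_le_f (reflect_d _ Cu); have := b_ge0 (reflect_d _ Cv).
  rewrite !fbE !chiE bu fu bv fv => h1 h2; rewrite chiE in chid.
  have h3 : 1 <= 2 * b d by lra.
  have h4 : 1 <= 2 * (l * (f d - b d)) by lra.
  have h5 : l * (f d - b d) + b d = 1 by lra.
  have h6 : b d = 2^-1 by lra.
  by split => //; rewrite h6 in h5; lra.
case: bd => bd lfd; have fd : f d = (2 * l)^-1 + 2^-1.
  by rewrite -[f d](mulKf (lt0r_neq0 l0)) lfd; field; rewrite gt_eqF.
exists (d - (2 * l)^-1 *: u - 2^-1 *: v); split.
- by rewrite !fbE fu fv fd; field; rewrite gt_eqF.
- by rewrite !fbE bu bv bd; field; rewrite gt_eqF.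
move=> p q k' fk' bk' Cx; have [_ _ /(_ _ Cx)] := c_center.
rewrite !fbE fu fv fk' => /reflect_d.
rewrite chiE !fbE fu fv fk' bu bv bk' fc bc.
set x := _ - _; set y := _ + _; suff -> : x = y by [].
by rewrite /x /y vE; vector_ext; field; rewrite gt_eqF.
Qed.

Lemma face_is_ray k : f k = 0 -> b k = 0 -> C (u + k) -> k = 0.
Proof.
move=> fk bk Cuk; have [m0 [fm0 bm0 T]] := twisted_boost (@ltr0Sn R 1).
(* For [l = 2], [p = 1], [q = 0] the twisted boost sends [u + k'] to [u / 2 + k' + 2 m0]; doubling
   gives [u + 2 k' + 4 m0]. *)
pose m := 4 *: m0.
have fm : f m = 0 by rewrite fbE fm0 mulr0.
have bm : b m = 0 by rewrite fbE bm0 mulr0.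
have step k' : f k' = 0 -> b k' = 0 -> C (u + k') -> C (u + (2 *: k' + m)).
  move=> fk' bk' Cuk'; have := T 1 0 k' fk' bk'.
  rewrite scale1r scale0r addr0 => /(_ Cuk') /CZ => /(_ 2 (ler0n _ _)).
  set x := _ *: _; suff -> : x = u + (2 *: k' + m) by [].
  by rewrite /x /m; vector_ext; field.
(* [k' |-> 2 k' + m] expands away from its fixed point [- m], and the face is
   bounded, so it is reduced to [- m]. *)
have fixed k' : f k' = 0 -> b k' = 0 -> C (u + k') -> k' + m = 0.
  move=> fk' bk' Cuk'; have iter n : C (u + (2 ^+ n *: (k' + m) - m)).
    elim: n => [|n IHn]; first by rewrite expr0 scale1r addrK.
    have -> : 2 ^+ n.+1 *: (k' + m) - m = 2 *: (2 ^+ n *: (k' + m) - m) + m.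
      by rewrite exprS; vector_ext; ring.
    by apply: step IHn; rewrite !fbE ?fk' ?bk' ?fm0 ?bm0; ring.
  apply: kernel_cone; last by rewrite fbE fk' fm addr0.
  (* Divided by [2 ^+ n], the iterates become [k' + m + (u - m) / 2 ^+ n], which tend to [k' + m], a
     point of the kernel of [f]. *)
  apply: (C_line_closed (y := u - m)) => e /exists_expr2_lt[n ne].
  have e0 : 0 <= (2 ^+ n)^-1 :> R by rewrite invr_ge0 exprn_ge0.
  exists (2 ^+ n)^-1; split=> //; move: (CZ (iter n) e0).
  set x := _ *: _; set y := _ + _; suff -> : x = y by [].
  by rewrite /x /y; vector_ext; field; rewrite expf_neq0.
have m_eq0 : m = 0 by rewrite -[m]add0r fixed ?scalar0 // addr0.
by rewrite -[k]addr0 -m_eq0 fixed.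
Qed.

(** The twisted boost sends [u] to [u / l + 2 m]. Rescaled by [l], this is a point [u + 2 l m] of
    the face at [u], so the translation part [m] vanishes. *)
Lemma boost l p q k : 0 < l -> f k = 0 -> b k = 0 ->
  C (p *: u + q *: v + k) -> C ((p / l) *: u + (q * l) *: v + k).
Proof.
move=> l0 fk bk Cx; have [m [fm bm T]] := twisted_boost l0.
suff m_eq0 : m = 0 by have := T _ _ _ fk bk Cx; rewrite m_eq0 scaler0 addr0.
have := T 1 0 0 (scalar0 _) (scalar0 _).
rewrite scale1r scale0r !addr0 => /(_ Cu) /CZ => /(_ l (ltW l0)) Cl.
have : (2 * l) *: m = 0.
  apply: face_is_ray; rewrite ?fbE ?fm ?bm ?mulr0 //.
  move: Cl; set x := _ *: _; suff -> : x = u + (2 * l) *: m by [].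
  by rewrite /x; vector_ext; field; rewrite gt_eqF.
by move/eqP; rewrite scaler_eq0 mulf_eq0 pnatr_eq0 (gt_eqF l0) => /eqP.
Qed.

(** The vector is [p u + q v + k] with [p = (r + a) / 2] and [q = (r - a) / 2]. A boost equalizes
    both coefficients to [sqrt (p q)], and [u + v = 2 c] while [4 p q = r^2 - a^2]. When [p q = 0]
    no boost does this, but then the faces at [u] and [v] being rays forces [k = 0]. *)
Lemma section_pythagoras r a k : f k = 0 -> b k = 0 ->
  C (r *: c + a *: (u - c) + k) <->
  `|a| <= r /\ C (Num.sqrt (r ^+ 2 - a ^+ 2) *: c + k).
Proof.
move=> fk bk; pose p := (r + a) / 2; pose q := (r - a) / 2.
have xE : r *: c + a *: (u - c) + k = p *: u + q *: v + k.
  by rewrite /p /q vE; vector_ext; field.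
have yE t : t *: c + k = (t / 2) *: u + (t / 2) *: v + k.
  by rewrite vE; vector_ext; field.
have pqE : r ^+ 2 - a ^+ 2 = 4 * (p * q) by rewrite /p /q; field.
have Cv : C v by have [_ _ /(_ _ Cu)] := c_center; rewrite fu mulr1 vE.
(* The reflection in [c] exchanges [u] and [v], so it carries the face property from [u] to [v]. *)
have face k' : f k' = 0 -> b k' = 0 -> C (v + k') -> k' = 0.
  move=> fk' bk'; have [_ _ refl_c] := c_center => /refl_c.
  rewrite fbE fv fk' addr0 mulr1 => Cuk.
  apply: oppr_inj; rewrite oppr0; apply: face_is_ray; rewrite ?fbE ?fk' ?bk' ?oppr0 //.
  by move: Cuk; rewrite vE opprD opprB addrA [2 *: c + _]addrC subrK.
have edge (s : R) z : 0 <= s ->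
    (forall k', f k' = 0 -> b k' = 0 -> C (z + k') -> k' = 0) ->
    C (s *: z + k) -> k = 0.
  rewrite le_eqVlt => /predU1P[<- _|s0 facez Cz].
    by rewrite scale0r add0r => Ck; exact: kernel_cone.
  suff : s^-1 *: k = 0 by move/eqP; rewrite scaler_eq0 invr_eq0 gt_eqF //= => /eqP.
  apply: facez; rewrite ?fbE ?fk ?bk ?mulr0 //.
  have sV0 : 0 <= s^-1 by rewrite invr_ge0 ltW.
  by move: (CZ Cz sV0); rewrite scalerDr scalerA mulVf ?gt_eqF // scale1r.
have balance : 0 <= p -> 0 <= q -> p * q != 0 -> exists l,
    [/\ 0 < l, p / l = Num.sqrt (4 * (p * q)) / 2 &
      q * l = Num.sqrt (4 * (p * q)) / 2].
  move=> p0 q0 pq0; pose t := Num.sqrt (p * q).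
  have -> : Num.sqrt (4 * (p * q)) / 2 = t.
    rewrite sqrtrM // (_ : 4 = 2 ^+ 2); last by ring.
    by rewrite sqrtr_sqr ger0_norm // mulrC mulKf ?pnatr_eq0.
  have {}pq0 : 0 < p * q by rewrite lt0r pq0 mulr_ge0.
  have t0 : 0 < t by rewrite sqrtr_gt0.
  have tt : t * t = p * q by rewrite -expr2 sqr_sqrtr // ltW.
  have pN0 : p != 0 by apply: contraTneq pq0 => ->; rewrite mul0r ltxx.
  exists (p / t); split; first by rewrite divr_gt0 // lt0r pN0.
    by field; rewrite pN0 gt_eqF.
  by rewrite mulrA [q * p]mulrC -tt mulfK ?gt_eqF.
split=> [Cx|[ar Cy]].
- have p0 : 0 <= p.
    by have := b_le_f Cx; rewrite xE !fbE fu fv fk bu bv bk; lra.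
  have q0 : 0 <= q.
    by have := b_ge0 Cx; rewrite xE !fbE bu bv bk; lra.
  split; first by rewrite ler_norml; move: p0 q0; rewrite /p /q; lra.
  rewrite pqE; have [pq0|pq0] := eqVneq (p * q) 0.
    suff -> : k = 0 by rewrite pq0 mulr0 sqrtr0 scale0r addr0.
    move: Cx; rewrite xE; move/eqP: pq0; rewrite mulf_eq0 => /orP[]/eqP ->.
      by rewrite scale0r add0r; exact: edge.
    by rewrite scale0r addr0; apply: edge => // k'; exact: face_is_ray.
  have [l [l0 pl ql]] := balance p0 q0 pq0.
  by move: Cx; rewrite xE => /(boost l0 fk bk); rewrite yE pl ql.
- have [p0 q0] : 0 <= p /\ 0 <= q.
    by move: ar; rewrite ler_norml /p /q; lra.
  move: Cy; rewrite pqE xE; have [pq0|pq0] := eqVneq (p * q) 0.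
    rewrite pq0 mulr0 sqrtr0 scale0r add0r => /kernel_cone -> //; rewrite addr0.
    by move/eqP: pq0; rewrite mulf_eq0 => /orP[]/eqP ->;
      rewrite scale0r ?add0r ?addr0; exact: CZ.
  have [l [l0 pl ql]] := balance p0 q0 pq0.
  have lV0 : 0 < l^-1 by rewrite invr_gt0.
  rewrite yE => /(boost lV0 fk bk).
  by rewrite -{1}pl -ql invrK divfK ?mulfK ?gt_eqF.
Qed.

End Boost.

(** * Euclidean coordinates by induction on the dimension *)

Section Coordinates.
Variables (R : realType) (V : vectType R) (C : set V).
Hypothesis C0 : C 0.
Hypothesis CD : forall x y, C x -> C y -> C (x + y).
Hypothesis CZ : forall x (l : R), C x -> 0 <= l -> C (l *: x).
Hypothesis C_line_closed : line_closed C.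
Hypothesis C_center :
  forall f : {scalar V}, positive_on C f -> exists c, section_center C f c.
Variables (f : {scalar V}) (c : V).
Hypothesis f_pos : positive_on C f.
Hypothesis c_center : section_center C f c.
Implicit Types (M : {vspace V}).

Let fc : f c = 1. Proof. by case: c_center. Qed.

Let kernel_cone k : C k -> f k = 0 -> k = 0. Proof. exact: positive_on_kernel. Qed.

Let f_ge0 x : C x -> 0 <= f x. Proof. exact: positive_on_ge0. Qed.

(** [t] is the supremum of the admissible [s]. Were these unbounded, the points [y + c / s] of [C]
    would put [y] itself in [C], against [f y = 0]; closedness makes the supremum attained. *)
Lemma boundary_point y l : y != 0 -> f y = 0 -> C (l *: c + y) ->
  exists t : R, [/\ 0 < t, C (c + t *: y) & forall s, C (c + s *: y) -> s <= t].
Proof.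
move=> y0 fy Cl.
have l0 : 0 < l.
  rewrite lt0r; have := f_ge0 Cl; rewrite !(scalarE f) fc fy mulr1 addr0 => ->.
  rewrite andbT; apply: contraNneq y0 => l0.
  by move: Cl; rewrite l0 scale0r add0r => /kernel_cone ->.
pose A : set R := [set s | C (c + s *: y)].
have Al : A l^-1.
  rewrite /A /=; have -> : c + l^-1 *: y = l^-1 *: (l *: c + y).
    by vector_ext; field; rewrite gt_eqF.
  by apply: CZ => //; rewrite invr_ge0 ltW.
have supA : has_sup A.
  split; first by exists l^-1.
  apply: contrapT => nub; suff Cy : C y by rewrite (kernel_cone Cy fy) eqxx in y0.
  apply: (C_line_closed (y := c)) => e e0; apply: contrapT => ne; apply: nub.
  exists e^-1 => s As; rewrite leNgt; apply/negP => es; apply: ne.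
  have s0 : 0 < s by apply: lt_trans es; rewrite invr_gt0.
  exists s^-1; split; first by rewrite invr_ge0 ltW.
    by rewrite -[e]invrK ltf_pV2 ?posrE ?invr_gt0.
  have -> : y + s^-1 *: c = s^-1 *: (c + s *: y).
    by vector_ext; field; rewrite gt_eqF.
  by apply: CZ => //; rewrite invr_ge0 ltW.
exists (sup A); split; last by move=> s As; apply: ub_le_sup => //; case: supA.
  apply: (@lt_le_trans _ _ l^-1); first by rewrite invr_gt0.
  by apply: ub_le_sup => //; case: supA.
apply: (C_line_closed (y := - y)) => e e0; have [s As es] := sup_adherent e0 supA.
exists (sup A - s); split.
- by rewrite subr_ge0; apply: ub_le_sup => //; case: supA.
- by rewrite ltrBlDr -ltrBlDl.
- suff -> : c + sup A *: y + (sup A - s) *: - y = c + s *: y by [].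
  by vector_ext; ring.
Qed.

(** On the plane of [c] and [w] the form [r c + a w |-> (r - a) / 2] is nonnegative on [C] by
    maximality of [w]. It extends to [V] by Riesz, the reflection in [c] showing that multiples of
    [c] dominate every vector of [C]. *)
Lemma supporting_form w : w != 0 -> f w = 0 -> C (c + w) ->
    (forall s : R, C (c + s *: w) -> s <= 1) ->
  exists b : {scalar V}, [/\ forall x, C x -> 0 <= b x, b (c + w) = 0 & b c = 2^-1].
Proof.
move=> w0 fw Cw w_max.
have wc : w \notin <[c]>%VS.
  apply: contra w0 => /vlineP[t wt]; move: fw.
  by rewrite wt (scalarE f) fc mulr1 => ->; rewrite scale0r.
have [h [hc hw]] := scalar_separation wc.
have {}hc : h c = 0 by apply: hc; exact: memv_line.
pose g : {scalar V} := scomb (2^-1) (- 2^-1) f h.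
have gE r a : g (r *: c + a *: w) = (r - a) / 2.
  by rewrite /= /scomb !(scalarE f, scalarE h) fc fw hc hw; field.
have [|||b [bg b0]] := @riesz_extension _ _ C CD CZ (<[c]> + <[w]>)%VS g c.
- by rewrite (subvP (addvSl _ _)) ?memv_line.
- by move=> x Cx; exists (2 * f x); have [_ _] := c_center; exact.
- move=> _ /memv_addP[_ /vlineP[r ->] [_ /vlineP[a ->] ->]] Cx.
  rewrite gE divr_ge0 // subr_ge0 leNgt; apply/negP => ra.
  have : 0 <= r by have := f_ge0 Cx; rewrite !(scalarE f) fc fw mulr1 mulr0 addr0.
  rewrite le_eqVlt => /predU1P[r0|r0].
    have : a *: w = 0.
      apply: kernel_cone; last by rewrite (scalarE f) fw mulr0.
      by move: Cx; rewrite -r0 scale0r add0r.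
    by move/eqP; rewrite scaler_eq0 (negPf w0) orbF; move: ra; rewrite -r0; case: ltgtP.
  have : a / r <= 1.
    apply: w_max; have -> : c + (a / r) *: w = r^-1 *: (r *: c + a *: w).
      by vector_ext; field; rewrite gt_eqF.
    by apply: CZ => //; rewrite invr_ge0 ltW.
  by rewrite ler_pdivrMr // mul1r leNgt ra.
have cE : c = 1 *: c + 0 *: w by rewrite scale1r scale0r addr0.
have cwE : c + w = 1 *: c + 1 *: w by rewrite !scale1r.
have inM r a : r *: c + a *: w \in (<[c]> + <[w]>)%VS.
  by apply: memv_add; apply: memvZ; exact: memv_line.
exists b; split => //.
  by rewrite cwE bg // gE; field.
by rewrite [c in b c]cE bg // gE; field.
Qed.

(** A vector [w] of [M] is scaled until [c + w] is on the boundary; the supporting form [b] there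
    splits [M] into the line of [w] and [M' = M :&: sker b], of smaller dimension. The radius [r] is
    arbitrary because Pythagoras replaces it by [sqrt (r^2 - a^2)] on [M']. *)
Lemma ball_coordinates M : (forall x, x \in M -> f x = 0) ->
    (forall x, x \in M -> exists l : R, C (l *: c + x)) ->
  exists n (w : 'I_n -> V),
    [/\ forall i, w i \in M,
        forall x, x \in M -> exists a : 'I_n -> R, x = \sum_i a i *: w i &
        forall r (a : 'I_n -> R), C (r *: c + \sum_i a i *: w i) <->
          0 <= r /\ \sum_i a i ^+ 2 <= r ^+ 2].
Proof.
have [d] := ubnP (\dim M); elim: d M => // d IHd M ltMd fM unitM.
have [M0|M0] := eqVneq M 0%VS.
  exists 0%N, (fun=> 0); split=> [[]//|x|r a].
    by rewrite M0 memv0 => /eqP ->; exists (fun=> 0); rewrite big_ord0.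
  rewrite !big_ord0 addr0; split=> [/f_ge0|[r0 _]].
    by rewrite (scalarE f) fc mulr1 => r0; split=> //; exact: sqr_ge0.
  by apply: CZ => //; case: c_center.
have y0 : vpick M != 0 by rewrite vpick0.
have yM := memv_pick M; have [l Cl] := unitM _ yM.
have [t [t0 Ct t_max]] := boundary_point y0 (fM _ yM) Cl.
pose w := t *: vpick M; have wM : w \in M by exact: memvZ.
have fw := fM _ wM.
have w0 : w != 0 by rewrite scaler_eq0 negb_or gt_eqF.
have w_max s : C (c + s *: w) -> s <= 1.
  by rewrite /w scalerA => /t_max; rewrite -{2}[t]mul1r ler_pM2r.
have Cu : C (c + w) by [].
clearbody w; have [b [b0 bw bc]] := supporting_form w0 fw Cu w_max.
have {}bw : b w = - 2^-1 by move: bw; rewrite scalarD bc; lra.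
pose M' := (M :&: sker b)%VS.
have M'P x : (x \in M') = (x \in M) && (b x == 0) by rewrite memv_cap mem_sker.
have [|x|x|n [e [eM' e_gen eC]]] := IHd M'.
- by move: ltMd; rewrite -(dim_cap_sker (f := b) wM) // bw oppr_eq0 invr_eq0 pnatr_eq0.
- by rewrite M'P => /andP[/fM].
- by rewrite M'P => /andP[/unitM].
exists n.+1, (fun i => if unlift ord0 i is Some j then e j else w).
have sumE (a : 'I_n.+1 -> R) :
    \sum_i a i *: (if unlift ord0 i is Some j then e j else w) =
    a ord0 *: w + \sum_j a (lift ord0 j) *: e j.
  rewrite big_ord_recl unlift_none; congr (_ + _).
  by apply: eq_bigr => j _; rewrite liftK.
split=> [i|x xM|r a].
- by case: unliftP => [j|] _ //; have := eM' j; rewrite M'P => /andP[].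
(* Since [b w = - 1/2], the component of [x] along [w] is [- 2 b x]. *)
- have /e_gen[a xa] : x - (- 2 * b x) *: w \in M'.
    by rewrite M'P memvB ?memvZ // !(scalarE b) bw /=; apply/eqP; field.
  exists (fun i => if unlift ord0 i is Some j then a j else - 2 * b x).
  rewrite sumE unlift_none; under eq_bigr do rewrite liftK.
  by rewrite -xa addrC subrK.
rewrite sumE big_ord_recl addrA; set k := \sum_j _ *: e j.
have kM' : k \in M' by apply: memv_suml => j _; exact: memvZ.
have [kM bk] : k \in M /\ b k = 0 by move: kM'; rewrite M'P => /andP[? /eqP].
have wE : w = (c + w) - c by rewrite addrC addKr.
have fu : f (c + w) = 1 by rewrite scalarD fc fw addr0.
have bu : b (c + w) = 0 by rewrite scalarD bc bw subrr.
have := section_pythagoras C0 CZ C_line_closed C_center f_pos c_center b0 Cu bu fu bc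
  (erefl _) r (a ord0) (fM _ kM) bk.
rewrite -wE => ->; rewrite /k eC.
split=> [[ar [_]]|[r0 sumr]].
  have r0 : 0 <= r by apply: le_trans ar.
  rewrite sqr_sqrtr => [h|]; first by split=> //; lra.
  by rewrite subr_ge0 -[leLHS]real_normK ?num_real // ler_pXn2r ?nnegrE.
have S0 : 0 <= \sum_(i < n) a (lift ord0 i) ^+ 2.
  by apply: sumr_ge0 => j _; exact: sqr_ge0.
have ar : a ord0 ^+ 2 <= r ^+ 2 by lra.
split.
  by rewrite -(@ler_pXn2r _ 2) ?nnegrE // real_normK ?num_real.
by rewrite sqrtr_ge0 sqr_sqrtr ?subr_ge0 //; split=> //; lra.
Qed.

End Coordinates.

(** * Closedness, compactness and boundedness in coordinates *)

Section Topology.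
Import VectorInternalTheory.
Variables (R : realType) (V : vectType R).
Implicit Types (f : {scalar V}) (C S : set V).

Lemma vclosed_line_closed C : vclosed C -> line_closed C.
Proof.
move=> clC x y Cxy; suff : (v2r @` C) (v2r x) by move=> [z Cz /v2r_inj <-].
apply: clC => B /nbhs_ballP[e e0 eB].
have ny0 : 0 < `|v2r y| + 1 by rewrite ltr_wpDl.
have [d [d0 de Cd]] := Cxy (e / (`|v2r y| + 1)) (divr_gt0 e0 ny0).
exists (v2r (x + d *: y)); split; first by exists (x + d *: y).
apply: eB; rewrite -ball_normE /= linearD linearZ /= opprD addrA subrr add0r.
rewrite normrN normrZ ger0_norm //; apply: le_lt_trans (_ : d * (`|v2r y| + 1) < e).
  by rewrite ler_wpM2l // lerDl.
by rewrite -ltr_pdivlMr.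
Qed.

Lemma scalar_r2v_continuous f : continuous (fun y : 'rV[R]_(dim V) => f (r2v y)).
Proof.
have fE (y : 'rV[R]_(dim V)) :
    f (r2v y) = \sum_j f (r2v (delta_mx 0 j)) * y 0 j.
  rewrite {1}(row_sum_delta y) !linear_sum /=; apply: eq_bigr => j _.
  by rewrite linearZ scalarZ mulrC.
under [X in continuous X]eq_fun do rewrite fE.
apply: continuous_big => [|j _ y].
  exact: add_continuous.
apply: (@cvgM R _ (nbhs y) _ (fun=> _) (fun z : 'rV_(dim V) => z 0 j)).
  exact: cvg_cst.
exact: coord_continuous.
Qed.

(** By compactness [f] has a minimum [m > 0] on the unit vectors of [C], so a point of [C] with
    [f x = 1] has norm at most [m^-1]. *)
Lemma positive_section_bounded C f : vclosed C ->
    (forall x (l : R), C x -> 0 <= l -> C (l *: x)) -> positive_on C f ->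
  vbounded (C `&` [set x | f x = 1]).
Proof.
move=> clC CZ f_pos.
pose K := (v2r @` C) `&` (Num.norm @^-1` [set x | x = 1] : set 'rV[R]_(dim V)).
have K_bounded (m : R) : 0 < m -> (forall y, K y -> m <= f (r2v y)) ->
    vbounded (C `&` [set x | f x = 1]).
  move=> m0 mK; exists m^-1; split; first exact: num_real.
  move=> t mt _ [x [Cx /= fx] <-]; apply: le_trans (ltW mt).
  have x0 : v2r x != 0.
    apply: contra_eq_neq fx => x0; have -> : x = 0 by apply: v2r_inj; rewrite linear0.
    by rewrite scalar0 eq_sym oner_eq0.
  rewrite -[leLHS]invrK lef_pV2 ?posrE ?invr_gt0 ?normr_gt0 //.
  have := mK (v2r (`|v2r x|^-1 *: x)); rewrite v2rK scalarZ fx mulr1; apply.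
  split; first by exists (`|v2r x|^-1 *: x) => //; apply: CZ; rewrite // invr_ge0.
  by rewrite /= linearZ /= normrZ normfV normr_id mulVf // normr_eq0.
have [K0|/nonemptyPn K0] := pselect (K !=set0); last first.
  by apply: (K_bounded 1) => // y Ky; exfalso; rewrite K0 in Ky.
have cK : compact K.
  apply: bounded_closed_compact.
    by exists 1; split; [exact: num_real|move=> t t1 y [_ /= ->]; exact: ltW].
  apply: closedI => //; apply: preimage_closed.
    by move=> y _; exact: norm_continuous.
  exact: closed_eq.
have [|y yK ymin] := @EVT_min_rV _ _ (fun y => f (r2v y)) K K0 cK.
  by apply: continuous_subspaceT; exact: scalar_r2v_continuous.
move: yK; rewrite inE => -[[x Cx xy] /= ny1].
apply: (K_bounded (f x)) => [|z Kz]; last first.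
  by have := ymin z; rewrite inE -xy v2rK; exact.
apply: f_pos => //; apply: contra_eq_neq ny1 => x0.
by rewrite -xy x0 linear0 normr0 eq_sym oner_eq0.
Qed.

Lemma bounded_no_ray S y z :
  vbounded S -> (forall t : R, 0 <= t -> S (y + t *: z)) -> z = 0.
Proof.
move=> [M [_ bM]] ray; apply: v2r_inj; rewrite linear0; apply/eqP.
rewrite -normr_le0 leNgt; apply/negP => z0.
pose N := `|M| + 1 + `|v2r y|; have N0 : 0 < N by rewrite /N ltr_wpDr // ltr_wpDl.
have MN : M < `|M| + 1 by rewrite ltr_pwDr // ler_norm.
have t0 : 0 < (N + 1) / `|v2r z| by rewrite divr_gt0 // ltr_wpDl ?ltW.
have := bM _ MN (v2r (y + ((N + 1) / `|v2r z|) *: z)).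
have Sx : (v2r @` S) (v2r (y + ((N + 1) / `|v2r z|) *: z)).
  by eexists; [apply: ray (ltW t0)|].
move=> /(_ Sx); rewrite linearD linearZ /= addrC => h.
have := lerB_normD (((N + 1) / `|v2r z|) *: v2r z) (v2r y).
rewrite normrZ gtr0_norm // divfK ?gt_eqF // /N => h'.
have := le_trans h' h; lra.
Qed.

End Topology.

(** * Affine spans, dimension and sections *)

Section Dimension.
Variables (R : realType) (V : vectType R).
Implicit Types (f : {scalar V}) (C S K H : set V) (U W : {vspace V}).

Lemma sub_affine_span K x : K x -> affine_span K x.
Proof.
move=> Kx; exists 1%N, (fun=> 1), (fun=> x).
by rewrite !big_ord1 scale1r.
Qed.

Lemma affine_span_nonempty K x : affine_span K x -> K !=set0.
Proof.
move=> [[|n] [a [k [Kk suma _]]]]; last by exists (k ord0).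
by move: suma; rewrite big_ord0 => /eqP; rewrite eq_sym oner_eq0.
Qed.

Lemma flat_refl p U : flat p U p.
Proof. by rewrite /flat /= subrr mem0v. Qed.

Lemma has_dim_nonempty K d : has_dim K d -> K !=set0.
Proof.
move=> [p [U [spanK _]]]; apply: (@affine_span_nonempty _ p).
by rewrite spanK; exact: flat_refl.
Qed.

Lemma flat_sub p q U W : flat p U = flat q W -> (U <= W)%VS.
Proof.
move=> eqF; apply/subvP => x xU.
have : flat q W (p + x) by rewrite -eqF /flat /= addrC addKr.
have : flat q W p by rewrite -eqF; exact: flat_refl.
rewrite /flat /= => h1 h2; have -> : x = (p + x - q) - (p - q) by vector_ext; ring.
exact: memvB.
Qed.

Lemma has_dim_uniq K d e : has_dim K d -> has_dim K e -> d = e.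
Proof.
move=> [p [U [spU <-]]] [q [W [spW <-]]]; rewrite spU in spW.
by congr (\dim _); apply/eqP; rewrite eqEsubv !(flat_sub spW, flat_sub (esym spW)).
Qed.

Lemma has_dim_set1 (x : V) : has_dim [set x] 0.
Proof.
exists x, 0%VS; split; last by rewrite dimv0.
apply/seteqP; split=> y; last first.
  rewrite /flat /= memv0 subr_eq0 => /eqP ->; exact: sub_affine_span.
move=> [n [a [k [kx suma ->]]]]; rewrite /flat /= memv0 subr_eq0; apply/eqP.
rewrite (eq_bigr (fun i => a i *: x)) => [|i _]; last by rewrite kx.
by rewrite -scaler_suml suma scale1r.
Qed.

Lemma has_dim0_singleton K : has_dim K 0 -> exists x, K = [set x].
Proof.
move=> dimK; have [x Kx] := has_dim_nonempty dimK; exists x.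
have [p [U [spanK /eqP]]] := dimK; rewrite dimv_eq0 => /eqP U0.
have Kp y : K y -> y = p.
  by move/sub_affine_span; rewrite spanK U0 /flat /= memv0 subr_eq0 => /eqP.
by apply/seteqP; split=> y => [/Kp ->|->] //; rewrite (Kp x).
Qed.

(** [W] is a span of finitely many vectors of [C] of the largest possible dimension, so no vector of
    [C] can enlarge it. *)
Lemma exists_linear_span C : exists W, (forall x, C x -> x \in W) /\
  forall x, x \in W -> exists n (a : 'I_n -> R) (k : 'I_n -> V),
    (forall i, C (k i)) /\ x = \sum_i a i *: k i.
Proof.
pose P d := `[< exists X : seq V, (forall x, x \in X -> C x) /\ \dim <<X>> = d >].
have exP : exists d, P d.
  by exists 0%N; apply/asboolP; exists [::]; rewrite span_nil dimv0.
have leP d : P d -> (d <= \dim {:V})%N by move/asboolP => [X [_ <-]]; exact/dimvS/subvf.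
case: (ex_maxnP exP leP) => d /asboolP[X [CX dX]] max_d.
exists <<X>>%VS; split=> [x Cx|x].
  have sX : (<<X>> <= <<x :: X>>)%VS by rewrite span_cons addvSr.
  have : P (\dim <<x :: X>>).
    by apply/asboolP; exists (x :: X); split=> // y; rewrite inE => /predU1P[->|/CX].
  move/max_d => le_d; have /eqP -> : <<X>>%VS == <<x :: X>>%VS.
    by rewrite eqEdim sX dX.
  by rewrite memv_span // mem_head.
move=> /(coord_span (X := in_tuple X)) ->.
exists (size X), (fun i => coord (in_tuple X) i x), (fun i => X`_i).
by split=> // i; apply/CX/mem_nth.
Qed.

(** A linear combination of points of [C] becomes an affine one when the point 0 receives the
    missing weight [1 - \sum_j a j]. *)
Lemma has_dim_cone C W : C 0 -> (forall x, C x -> x \in W) ->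
    (forall x, x \in W -> exists n (a : 'I_n -> R) (k : 'I_n -> V),
      (forall i, C (k i)) /\ x = \sum_i a i *: k i) ->
  has_dim C (\dim W).
Proof.
move=> C0 CW genW; exists 0, W; split=> //; apply/seteqP; split=> x.
  move=> [n [a [k [Ck _ ->]]]]; rewrite /flat /= subr0.
  by apply: memv_suml => i _; apply/memvZ/CW.
rewrite /flat /= subr0 => /genW[n [a [k [Ck ->]]]].
exists n.+1, (fun i => if unlift ord0 i is Some j then a j else 1 - \sum_j a j),
  (fun i => if unlift ord0 i is Some j then k j else 0).
split=> [i||]; first by case: unliftP.
  rewrite big_ord_recl unlift_none [X in _ + X](eq_bigr a) ?subrK // => j _.
  by rewrite liftK.
rewrite big_ord_recl !unlift_none scaler0 add0r.
by apply: eq_bigr => i _; rewrite liftK.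
Qed.

Lemma affine_hyperplane_level f y : f y = 1 -> affine_hyperplane [set x | f x = 1].
Proof.
move=> fy; exists y, (sker f); split.
  by apply: (@sker_hyperplane _ _ f y); rewrite fy oner_eq0.
apply/seteqP; split=> x; rewrite /flat /= mem_sker scalarD scalarN fy subr_eq0.
  by move=> ->.
by move/eqP.
Qed.

(* The hypothesis on [f] covers the cones on which [f] is positive and also the
   lines, which satisfy [pointed]. *)
Lemma level_is_section C f y : C 0 -> C y -> y != 0 ->
    (forall x, C x -> x != 0 -> f x != 0 /\ C ((f x)^-1 *: x)) ->
  is_section C (C `&` [set x | f x = 1]).
Proof.
move=> C0 Cy y0 Cf; have [W [CW genW]] := exists_linear_span C.
have [fy Cz] := Cf _ Cy y0; pose z := (f y)^-1 *: y.
have fz : f z = 1 by rewrite scalarZ mulVf.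
exists [set x | f x = 1], (\dim (W :&: sker f)); split=> //.
- exact: affine_hyperplane_level fz.
- by rewrite (dim_cap_sker (CW _ Cy) fy); exact: has_dim_cone.
exists z, (W :&: sker f)%VS; split=> //; apply/seteqP; split=> x.
  move=> [n [a [k [Sk suma ->]]]]; rewrite /flat /= memv_cap mem_sker.
  apply/andP; split.
    by apply: memvB; [apply: memv_suml => i _; apply/memvZ/CW; case: (Sk i)|exact: CW].
  rewrite scalarD scalarN fz linear_sum /= (eq_bigr a) ?suma ?subrr // => i _.
  by rewrite scalarZ; case: (Sk i) => _ ->; rewrite mulr1.
rewrite /flat /= memv_cap mem_sker scalarD scalarN fz subr_eq0 => /andP[xW /eqP fx].
have /genW[n [a [k [Ck xE]]]] : x \in W by rewrite -[x](subrK z) memvD // CW.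
(* Each nonzero [k i] is normalized to the level [f = 1] and its weight adjusted; a zero [k i] is
   replaced by [z], with weight 0. *)
exists n, (fun i => a i * f (k i)),
  (fun i => if k i == 0 then z else (f (k i))^-1 *: k i); split.
- move=> i; case: eqVneq => [_|k0]; first by [].
  by have [fk Ck'] := Cf _ (Ck i) k0; split=> //=; rewrite scalarZ mulVf.
- by rewrite -fx xE linear_sum; apply: eq_bigr => i _; rewrite scalarZ.
- rewrite {1}xE; apply: eq_bigr => i _; case: eqVneq => [->|k0].
    by rewrite scalar0 mulr0 scaler0 scale0r.
  by have [fk _] := Cf _ (Ck i) k0; rewrite scalerA mulfK.
Qed.

(** Every section is a single point, which is its own center. *)
Lemma CSS_dim1 C : has_dim C 1 -> CSS C.
Proof.
move=> dimC S [H [d [_ _ dimC' dimS]]] _.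
have d0 : d = 0%N by apply: succn_inj; exact: has_dim_uniq dimC' dimC.
have [x ->] := has_dim0_singleton (eq_ind _ (has_dim S) dimS _ d0).
exists x; apply/seteqP; split=> y.
  by move=> ->; exists x => //; rewrite mulr2n addrK.
by move=> [_ -> <-] /=; rewrite mulr2n addrK.
Qed.

End Dimension.

(** * Pointed cones and their hyperplane sections *)

Section Cones.
Variables (R : realType) (V : vectType R).
Implicit Types (f g : {scalar V}) (C S H : set V).

Lemma convex_linear_coneP C : convex_linear_cone C ->
  [/\ C 0, forall x y, C x -> C y -> C (x + y) &
      forall x (l : R), C x -> 0 <= l -> C (l *: x)].
Proof.
move=> [[x0 Cx0] cvxC CZ]; split=> //.
  by rewrite -(scale0r x0); exact: CZ.
move=> x y Cx Cy; have h0 : 0 <= 2^-1 :> R by lra.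
have h1 : 2^-1 <= 1 :> R by lra.
have : C (2^-1 *: x + (1 - 2^-1) *: y).
  by have := cvxC x y (Itv01 h0 h1); rewrite !inE; exact.
have -> : x + y = 2 *: (2^-1 *: x + (1 - 2^-1) *: y) by vector_ext; field.
by move/CZ; apply.
Qed.

(** Let [f] define the hyperplane, with [f y = 1]. If [f z < 0] for some [z] in [C], then
    [z - f z *: y] lies in [C] and in the hyperplane, hence is 0; so [- y] is in [C], and the same
    argument gives [x = f x *: y] for all [x] in [C]. *)
Lemma pointed_cases C y : C y -> y != 0 ->
    (forall x x', C x -> C x' -> C (x + x')) ->
    (forall x (l : R), C x -> 0 <= l -> C (l *: x)) -> pointed C ->
  (exists f, positive_on C f) \/ C = [set` <[y]>%VS].
Proof.
move=> Cy y0 CD CZ [U [hU CU]].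
have kerC x : C x -> x \in U -> x = 0.
  by move=> Cx xU; have : ([set` U] `&` C) x by []; rewrite CU.
have yU : y \notin U by apply: contra y0 => /(kerC _ Cy) ->.
have [f [fy fU]] := hyperplane_scalar hU yU.
have fN0 x : C x -> x != 0 -> f x != 0.
  by move=> Cx; apply: contra; rewrite -fU => /(kerC _ Cx) ->.
have [pos|/existsNP[z /not_implyP[Cz /not_implyP[z0 fz]]]] := pselect (positive_on C f).
  by left; exists f.
have {}fz : f z < 0.
  by rewrite lt_neqAle fN0 //= leNgt; apply/negP.
right; have zy : z = f z *: y.
  apply/eqP; rewrite -subr_eq0 -scaleNr; apply/eqP/kerC.
    by apply: CD => //; apply: CZ; rewrite // oppr_ge0 ltW.
  by rewrite fU !(scalarE f) fy mulr1 subrr.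
have CNy : C (- y).
  have -> : - y = (- (f z)^-1) *: z.
    by rewrite {2}zy scalerA mulNr mulVf ?lt_eqF // scaleN1r.
  by apply: CZ; rewrite // oppr_ge0 invr_le0 ltW.
apply/seteqP; split=> x /=.
  move=> Cx; apply/vlineP; exists (f x); apply/eqP; rewrite -subr_eq0; apply/eqP/kerC.
    have [fx|fx] := leP 0 (f x).
      by rewrite -scalerN; apply: CD => //; exact: CZ.
    by rewrite -scaleNr; apply: CD => //; apply: CZ; rewrite // oppr_ge0 ltW.
  by rewrite fU !(scalarE f) fy mulr1 subrr.
move=> /vlineP[t ->]; have [t0|t0] := leP 0 t; first exact: CZ.
by rewrite -[t]opprK scaleNr -scalerN; apply: CZ; rewrite // oppr_ge0 ltW.
Qed.

(** If [H] contains 0, each point of [S] spans a ray in [S]. Otherwise [H] is a level [h = 1], and a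
    nonzero [x] in [C] with [h x <= 0] gives the ray from [y] along [x - h x *: y]; its vanishing
    contradicts [f0 x > 0]. Excluding rays instead of assuming boundedness covers ellipsoids too. *)
Lemma section_without_ray C S H f0 : C 0 ->
    (forall x y, C x -> C y -> C (x + y)) ->
    (forall x (l : R), C x -> 0 <= l -> C (l *: x)) ->
    positive_on C f0 -> affine_hyperplane H -> S = C `&` H -> S !=set0 ->
    (forall y z, C z -> (forall t : R, 0 <= t -> S (y + t *: z)) -> z = 0) ->
  S = [set 0] \/ exists h : {scalar V}, positive_on C h /\ S = C `&` [set x | h x = 1].
Proof.
move=> C0 CD CZ f0_pos [p [U [hU HE]]] SE [y Sy] noray.
have [pU|pU] := boolP (p \in U).
  left; have HU x : H x <-> x \in U.
    by rewrite HE /flat /=; split=> h; [rewrite -[x](subrK p) memvD|exact: memvB].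
  have S0 x : S x -> x = 0.
    move=> Sx; have [Cx /HU xU] : (C `&` H) x by rewrite -SE.
    apply: (noray 0) => // t t0; rewrite add0r SE; split; first exact: CZ.
    by apply/HU/memvZ.
  by apply/seteqP; split=> x => [/S0 ->|->] //; rewrite -(S0 y).
right; have [h [hp hU']] := hyperplane_scalar hU pU.
have Hh : H = [set x | h x = 1].
  rewrite HE; apply/seteqP; split=> x; rewrite /flat /= hU' scalarD scalarN hp subr_eq0.
    by move/eqP.
  by move=> ->.
exists h; split; last by rewrite SE Hh.
move: Sy; rewrite SE Hh => -[Cy /= hy] x Cx x0; rewrite ltNge; apply/negP => hx.
have z0 : x - h x *: y = 0.
  apply: (noray y) => [|t t0].
    by rewrite -scaleNr; apply: CD => //; apply: CZ; rewrite // oppr_ge0.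
  rewrite SE Hh; split; last by rewrite /= !(scalarE h) hy; ring.
  apply/CD => //; apply/CZ => //; rewrite -scaleNr.
  by apply/CD => //; apply: CZ; rewrite // oppr_ge0.
have := f0_pos _ Cx x0; rewrite -(subrK (h x *: y) x) z0 add0r scalarZ.
by apply/negP; rewrite -leNgt mulr_le0_ge0 // (positive_on_ge0 f0_pos).
Qed.

End Cones.

(** * Euclidean structures: the dot product on rows, and Riesz representation *)

Section RowDot.
Variables (R : realType) (n : nat).

Definition row_dot (u v : 'rV[R]_n) : R := \sum_i u 0 i * v 0 i.

Fact row_dot_is_bilinear : bilinear_for
  (GRing.Scale.Law.clone _ _ ( *%R ) _)
  (GRing.Scale.Law.clone _ _ (idfun \; *%R) _) row_dot.
Proof.
split=> [v|u] a x y; rewrite /row_dot /= mulr_sumr -big_split /=;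
  by apply: eq_bigr => i _; rewrite !mxE; ring.
Qed.

Fact row_dot_sym u v : row_dot u v = (-1) ^+ false * idfun (row_dot v u).
Proof. by rewrite expr0 mul1r; apply: eq_bigr => i _; rewrite mulrC. Qed.

Fact row_dot_gt0 u : u != 0 -> 0 < row_dot u u.
Proof.
move=> u0; rewrite lt0r sumr_ge0 ?andbT => [|i _]; last by rewrite -expr2 sqr_ge0.
apply: contra u0; rewrite psumr_eq0 => [|i _]; last by rewrite -expr2 sqr_ge0.
move=> /allP u0; apply/eqP/rowP => i; rewrite mxE; apply/eqP.
by have := u0 i; rewrite mem_index_enum -expr2 sqrf_eq0 => /(_ isT).
Qed.

HB.instance Definition _ := bilinear_isBilinear.Build R 'rV[R]_n 'rV[R]_n R
  *%R (idfun \; *%R) row_dot row_dot_is_bilinear.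
HB.instance Definition _ := isHermitianSesquilinear.Build R 'rV[R]_n false idfun
  row_dot row_dot_sym.
HB.instance Definition _ := isDotProduct.Build R 'rV[R]_n row_dot row_dot_gt0.

Definition row_dot_form : {dot 'rV[R]_n for idfun} := row_dot.

End RowDot.

Section InnerProduct.
Variables (R : realType) (E : vectType R) (ip : {dot E for idfun}).

Lemma ipC x y : ip x y = ip y x.
Proof. by rewrite (hermC ip x y) expr0 mul1r. Qed.

Lemma ipDr x y z : ip x (y + z) = ip x y + ip x z.
Proof. exact: linearDr. Qed.

Lemma ipZr (a : R) x y : ip x (a *: y) = a * ip x y.
Proof. exact: linearZr_LR. Qed.

Lemma ipDl x y z : ip (x + y) z = ip x z + ip y z.
Proof. by rewrite ![ip _ z]ipC ipDr. Qed.

Lemma ipZl (a : R) x y : ip (a *: x) y = a * ip x y.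
Proof. by rewrite ![ip _ y]ipC ipZr. Qed.

Lemma ip0r x : ip x 0 = 0.
Proof. by rewrite -(scale0r 0) ipZr mul0r. Qed.

Lemma ip_gt0 x : x != 0 -> 0 < ip x x.
Proof. exact: neq0_dnorm_gt0. Qed.

Lemma mem_unit_ball x : unit_ball ip x <-> ip x x <= 1.
Proof. by rewrite /unit_ball /= -[X in _ <= X]sqrtr1 ler_sqrt. Qed.

(** The map [x |-> ip x] into the dual is injective by definiteness, hence onto by equality of
    dimensions. *)
Lemma riesz_representation (f : {scalar E}) : exists e, forall x, f x = ip e x.
Proof.
have lin e : exists g : 'Hom(E, R^o), forall x, g x = ip e x.
  have ie : linear (ip e : E -> R^o) by move=> a x y; rewrite ipDr ipZr.
  pose F := GRing.isLinear.Build R E R^o *:%R (ip e : E -> R^o) ie.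
  pose g : {linear E -> R^o} := HB.pack (ip e : E -> R^o) F.
  by exists (linfun g) => x; rewrite lfunE.
have [G GE] := choice lin.
have linG : linear G.
  by move=> a x y; apply/lfunP => z; rewrite add_lfunE scale_lfunE !GE ipDl ipZl.
pose F := GRing.isLinear.Build R E 'Hom(E, R^o) *:%R G linG.
pose H : {linear E -> 'Hom(E, R^o)} := HB.pack G F.
have ker0 : lker (linfun H) == 0%VS.
  apply/lker0P => x y; rewrite !lfunE /= => Gxy; apply/eqP; rewrite -subr_eq0.
  apply: contra_eqT Gxy => /ip_gt0; rewrite ipDl => /lt0r_neq0.
  apply: contra_neq => Gxy; rewrite -scaleN1r ipZl -!GE Gxy; ring.
have fullG : limg (linfun H) = fullv.
  apply/eqP; rewrite eqEdim subvf /= (limg_dim_eq (f := linfun H)).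
    by rewrite !dimvf /dim /= muln1.
  by rewrite (eqP ker0) capv0.
have [h hf] := linear_of_scalar f.
have : linfun h \in limg (linfun H) by rewrite fullG memvf.
move=> /memv_imgP[e _ he]; exists e => x; rewrite -hf -(lfunE h) he lfunE /=.
by rewrite GE.
Qed.

End InnerProduct.

(** * The two implications for a cone with a positive form *)

Section Directions.
Variables (R : realType) (V : vectType R) (C : set V).
Hypothesis C0 : C 0.
Hypothesis CD : forall x y, C x -> C y -> C (x + y).
Hypothesis CZ : forall x (l : R), C x -> 0 <= l -> C (l *: x).
Variable f0 : {scalar V}.
Hypothesis f0_pos : positive_on C f0.

Lemma CSS_section_center (f : {scalar V}) y : vclosed C -> CSS C ->
  C y -> y != 0 -> positive_on C f -> exists c, section_center C f c.
Proof.
move=> clC cssC Cy y0 f_pos; pose S := C `&` [set x | f x = 1].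
have normalize x : C x -> x != 0 -> S ((f x)^-1 *: x).
  move=> Cx x0; have fx := f_pos _ Cx x0; split.
    by apply: CZ => //; rewrite invr_ge0 ltW.
  by rewrite /= scalarZ mulVf // gt_eqF.
have secS : is_section C S.
  apply: (@level_is_section _ _ C f y) => // x Cx x0.
  by have [] := normalize _ Cx x0; split; first exact/lt0r_neq0/f_pos.
have [c Sc] := cssC _ secS (positive_section_bounded clC CZ f_pos).
have symS x : S x -> S (2 *: c - x).
  by move=> Sx; rewrite Sc; exists x; rewrite // scaler_nat.
have [c_in fc] : S c.
  have Sy := normalize _ Cy y0; have [[Cz fz] [Cz' fz']] := (Sy, symS _ Sy).
  (* The center belongs to the section as the midpoint of one of its points and the reflected
     point. *)
  have cE : c = 2^-1 *: ((f y)^-1 *: y) + 2^-1 *: (2 *: c - (f y)^-1 *: y).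
    by vector_ext; field; rewrite gt_eqF // f_pos.
  split; first by rewrite cE; apply: CD; apply: CZ; rewrite // invr_ge0 ler0n.
  by move: fz'; rewrite /= !(scalarE f) mulVf ?gt_eqF ?f_pos //; lra.
exists c; split=> // x Cx; have [->|x0] := eqVneq x 0.
  by rewrite scalar0 mulr0 scale0r subr0.
have fx := f_pos _ Cx x0; have [/CZ Cz _] := symS _ (normalize _ Cx x0).
have -> : (2 * f x) *: c - x = f x *: (2 *: c - (f x)^-1 *: x).
  by vector_ext; field; rewrite gt_eqF.
by apply: Cz; exact: ltW.
Qed.

(** The coordinates are taken on the directions [M] of the section [f0 = 1] within the linear span
    of [C]; at radius 1 they present this section as [c] plus the image of a unit ball. *)
Lemma CSS_ellipsoidal y : vclosed C -> CSS C -> C y -> y != 0 -> ellipsoidal_cone C.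
Proof.
move=> clC cssC Cy y0.
have center (f : {scalar V}) : positive_on C f -> exists c, section_center C f c.
  exact: CSS_section_center clC cssC Cy y0.
have [c c_center] := center _ f0_pos; have [Cc fc refl_c] := c_center.
have [W [CW genW]] := exists_linear_span C.
have unitW x : x \in W -> exists l : R, C (l *: c + x).
  move=> /genW[n [a [k [Ck ->]]]].
  apply: (big_ind (fun x => exists l : R, C (l *: c + x)))
    => [|x1 x2 [l1 C1] [l2 C2]|i _].
  - by exists 0; rewrite scale0r addr0.
  - exists (l1 + l2); rewrite scalerDl addrACA; exact: CD.
  have [ai|ai] := leP 0 (a i).
    by exists 0; rewrite scale0r add0r; exact: CZ.
  (* A negative multiple of [k i] is corrected by a multiple of [c] into a positive multiple of the
     reflected vector. *)
  exists (- a i * (2 * f0 (k i))).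
  have -> : (- a i * (2 * f0 (k i))) *: c + a i *: k i =
      (- a i) *: ((2 * f0 (k i)) *: c - k i) by vector_ext; ring.
  by apply: CZ; [exact: refl_c|rewrite oppr_ge0 ltW].
pose M := (W :&: sker f0)%VS.
have MP x : (x \in M) = (x \in W) && (f0 x == 0) by rewrite memv_cap mem_sker.
have [|x|n [w [wM genM ball]]] :=
    @ball_coordinates _ _ C C0 CD CZ (vclosed_line_closed clC) center f0 c
      f0_pos c_center M.
- by move=> x; rewrite MP => /andP[_ /eqP].
- by rewrite MP => /andP[/unitW].
exists (C `&` [set x | f0 x = 1]); split.
  apply: (@level_is_section _ _ C f0 y) => // x Cx x0; have fx := f0_pos Cx x0.
  by split; [rewrite gt_eqF|apply: CZ => //; rewrite invr_ge0 ltW].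
pose F (u : 'rV[R]_n) : V := \sum_i u 0 i *: w i.
have linF : linear F.
  move=> a u v; rewrite /F scaler_sumr -big_split; apply: eq_bigr => i _.
  by rewrite !mxE scalerDl scalerA.
pose isF := GRing.isLinear.Build R 'rV[R]_n V *:%R F linF.
pose L : {linear 'rV[R]_n -> V} := HB.pack F isF.
have ballE (u : 'rV[R]_n) : unit_ball (row_dot_form R n) u <-> C (c + F u).
  have := ball 1 (fun i => u 0 i); rewrite scale1r /F => ->.
  rewrite mem_unit_ball expr1n.
  by split=> [|[]] //; split.
have fF u : f0 (F u) = 0.
  rewrite linear_sum big1 // => i _; have := wM i.
  by rewrite MP scalarZ => /andP[_ /eqP ->]; rewrite mulr0.
exists 'rV[R]_n, (row_dot_form R n), L, c; apply/seteqP; split=> x.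
  move=> [Cx /= fx]; have /genM[a xa] : x - c \in M.
    by rewrite MP memvB ?CW // scalarD scalarN fx fc subrr /=.
  have xE : c + F (\row_i a i) = x.
    rewrite -[RHS](subrK c) addrC xa; congr (_ + _).
    by apply: eq_bigr => i _; rewrite mxE.
  by exists (\row_i a i) => //; apply/ballE; rewrite xE.
move=> [u /ballE Cu <-]; split=> //=.
by rewrite scalarD fc (fF u) addr0.
Qed.

(** An ellipsoid is symmetric about [p], so the opposite ray is in [C] as well, and [f0] becomes
    negative along it. *)
Lemma ellipsoid_no_ray S y z : is_ellipsoid S -> S `<=` C -> C z ->
  (forall t : R, 0 <= t -> S (y + t *: z)) -> z = 0.
Proof.
move=> [E [ip [f [p ->]]]] SC Cz ray.
apply/eqP; apply: contraT => /(f0_pos Cz) fz.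
have Cx t : 0 <= t -> C (2 *: p - (y + t *: z)).
  move=> /ray[b /mem_unit_ball Bb <-]; apply: SC; exists (- b).
    by apply/mem_unit_ball; rewrite -scaleN1r ipZr ipZl; lra.
  by rewrite linearN; vector_ext; ring.
pose N := `|2 * f0 p - f0 y| + 1.
have t0 : 0 <= N / f0 z by rewrite divr_ge0 ?ltW // ltr_wpDl.
have := positive_on_ge0 f0_pos (Cx _ t0); rewrite !(scalarE f0) divfK ?gt_eqF // /N.
by have := ler_norm (2 * f0 p - f0 y); lra.
Qed.

(** * Lorentz cones and the symmetry of their sections *)

Section Lorentz.
Variables (E : vectType R) (ip : {dot E for idfun}) (f : {linear E -> V}) (p : V).
Variables (g h : {scalar V}).
Hypothesis g_pos : positive_on C g.
Hypothesis h_pos : positive_on C h.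
Hypothesis ellipsoid : C `&` [set x | g x = 1] = [set p + f b | b in unit_ball ip].

Let in_ellipsoid b : ip b b <= 1 -> C (p + f b) /\ g (p + f b) = 1.
Proof.
move=> /mem_unit_ball Bb.
suff : (C `&` [set x | g x = 1]) (p + f b) by case.
by rewrite ellipsoid; exists b.
Qed.

Let gp : g p = 1.
Proof. by have [|_] := @in_ellipsoid 0; rewrite ?ip0r // linear0 addr0. Qed.

Let gf b : g (f b) = 0.
Proof.
have [->|b0] := eqVneq b 0; first by rewrite linear0 scalar0.
(* This factor brings [b] into the unit ball without a square root, as [x <= (1 + x)^2] for
   [x >= 0]. *)
have nb := ip_gt0 ip b0; pose t := (1 + ip b b)^-1.
have t0 : 0 < t by rewrite invr_gt0 ltr_wpDl // ltW.
have : ip (t *: b) (t *: b) <= 1.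
  rewrite ipZl ipZr mulrA /t -invfM mulrC ler_pdivrMr.
    by nra.
  by rewrite mulr_gt0 // ltr_wpDl // ltW.
move=> /in_ellipsoid[_]; rewrite linearZ scalarD scalarZ gp => /eqP.
by rewrite -subr_eq0 addrAC subrr add0r mulf_eq0 gt_eqF //= => /eqP.
Qed.

(** With [sub_Lorentz_cone], this presents [C] as the image of the cone [ip b b <= s^2], [s >= 0],
    under [(s, b) |-> s p + f b]. *)
Lemma Lorentz_cone_sub s b : 0 <= s -> ip b b <= s ^+ 2 -> C (s *: p + f b).
Proof.
rewrite le_eqVlt => /predU1P[<- b0|s0 bs].
  have -> : b = 0 by apply: contraTeq b0 => /ip_gt0; rewrite expr0n -ltNge.
  by rewrite scale0r linear0 addr0.
have [|Cb _] := @in_ellipsoid (s^-1 *: b).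
  by rewrite ipZl ipZr mulrA -invfM mulrC ler_pdivrMr ?mulr_gt0 // mul1r -expr2.
have -> : s *: p + f b = s *: (p + f (s^-1 *: b)).
  by rewrite linearZ scalerDr scalerA mulfV ?gt_eqF // scale1r.
by apply: CZ => //; exact: ltW.
Qed.

Lemma sub_Lorentz_cone x : C x ->
  exists b, x = g x *: p + f b /\ ip b b <= g x ^+ 2.
Proof.
move=> Cx; have [->|x0] := eqVneq x 0.
  by exists 0; rewrite scalar0 scale0r linear0 addr0 ip0r expr0n.
have gx := g_pos Cx x0.
have : (C `&` [set x | g x = 1]) ((g x)^-1 *: x).
  split; first by apply: CZ => //; rewrite invr_ge0 ltW.
  by rewrite /= scalarZ mulVf // gt_eqF.
rewrite ellipsoid => -[b /mem_unit_ball Bb xE]; exists (g x *: b); split.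
  by rewrite linearZ -scalerDr xE scalerA mulfV ?gt_eqF // scale1r.
by rewrite ipZl ipZr mulrA -expr2 ler_piMr // sqr_ge0.
Qed.

(** In coordinates [h] is [(s, b) |-> rho s + ip e b]. Its Lorentz dual [(rho, - e)], divided by
    [D], is the center [c], and [x |-> 2 c - x] on [h = 1] is a Lorentz reflection. *)
Lemma Lorentz_section_center :
  exists c, h c = 1 /\ forall x, C x -> h x = 1 -> C (2 *: c - x).
Proof.
have [hf hfE] : exists hf : {scalar E}, forall b, hf b = h (f b).
  have hl : scalar (h \o f) by move=> a x y; rewrite /= !linearP.
  pose F := GRing.isLinear.Build R E R *%R (h \o f) hl.
  pose k : {scalar E} := HB.pack (h \o f) F.
  by exists k.
have [e he] := riesz_representation ip hf.
have {}he b : h (f b) = ip e b by rewrite -hfE he.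
pose rho := h p.
have nz s b : s != 0 -> s *: p + f b != 0.
  apply: contra_neq => /(congr1 g).
  by rewrite !(scalarE g) gp gf mulr1 addr0.
have rho0 : 0 < rho.
  have Cp : C p.
    rewrite -(scale1r p) -[X in C X]addr0 -(linear0 f).
    by apply: Lorentz_cone_sub; rewrite ?ip0r ?expr1n.
  apply: h_pos => //; apply: contra_eq_neq gp => ->.
  by rewrite scalar0 eq_sym oner_eq0.
have Delta0 : 0 < rho ^+ 2 - ip e e.
  have [->|e0] := eqVneq e 0; first by rewrite ip0r subr0 exprn_gt0.
  have ne := ip_gt0 ip e0; pose r := Num.sqrt (ip e e).
  have r0 : 0 < r by rewrite sqrtr_gt0.
  have rr : r ^+ 2 = ip e e by rewrite sqr_sqrtr // ltW.
  (* At this lightlike vector [h] equals [r (rho - r)], whose positivity gives [rho > r]. *)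
  have Cx : C (r *: p + f (- 1 *: e)).
    by apply: Lorentz_cone_sub; [exact: ltW|rewrite ipZl ipZr rr; lra].
  have := h_pos Cx (nz _ _ (lt0r_neq0 r0)).
  rewrite !(scalarE h) he ipZr -/rho -rr => hx.
  have : 0 < r * (rho - r) by lra.
  by rewrite pmulr_rgt0 // subr_gt0 => r_rho; rewrite subr_gt0 ltr_pXn2r ?nnegrE ?ltW.
pose D := rho ^+ 2 - ip e e.
pose c := (rho / D) *: p + f ((- D^-1) *: e).
have hc : h c = 1.
  rewrite /c !(scalarE h) he ipZr -/rho.
  have -> : rho / D * rho + - D^-1 * ip e e = (rho ^+ 2 - ip e e) / D by ring.
  by rewrite divff // gt_eqF.
exists c; split=> // x Cx hx; have [b [xE bx]] := sub_Lorentz_cone Cx.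
pose s := 2 * rho / D - g x; pose b' := (- 2 * D^-1) *: e + (- 1) *: b.
have yE : 2 *: c - x = s *: p + f b'.
  have -> : f b' = (- 2 * D^-1) *: f e + (- 1) *: f b by rewrite linearD !linearZ.
  by rewrite [in LHS]xE /c /s linearZ; vector_ext; ring.
have hx' : rho * g x + ip e b = 1.
  by rewrite -hx [in RHS]xE scalarD scalarZ he mulrC.
have b's : ip b' b' <= s ^+ 2.
  (* The reflection preserves the Lorentz form: its values at [x] and at [2 c - x] agree. *)
  have -> : ip b' b' = s ^+ 2 - (g x ^+ 2 - ip b b).
    have eb : ip e b = 1 - rho * g x by lra.
    rewrite /b' !(ipDl, ipDr, ipZl, ipZr) (ipC ip b e) eb /s.
    have -> : ip e e = rho ^+ 2 - D by rewrite /D; ring.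
    by field; rewrite gt_eqF.
  by rewrite gerBl subr_ge0.
rewrite yE; apply: Lorentz_cone_sub => //; rewrite leNgt; apply/negP => s0.
(* Otherwise the opposite of [2 c - x] lies in [C], although [h] is negative there. *)
have Cy : C ((- s) *: p + f (- 1 *: b')).
  apply: Lorentz_cone_sub; first by rewrite oppr_ge0 ltW.
  by rewrite ipZl ipZr sqrrN; lra.
have sN0 : - s != 0 by rewrite oppr_eq0 lt_eqF.
have := h_pos Cy (nz _ _ sN0); have -> : (- s) *: p + f (- 1 *: b') = - (2 *: c - x).
  by rewrite yE scaleN1r linearN scaleNr opprD.
by rewrite scalarN scalarD scalarN scalarZ hc hx; lra.
Qed.

End Lorentz.

Lemma ellipsoidal_CSS : ellipsoidal_cone C -> CSS C.
Proof.
move=> [S0 [[H0 [d0 [affH0 S0E dimC dimS0]]] ellS0]].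
have S0C : S0 `<=` C by rewrite S0E; exact: subIsetl.
have [|S00|[g [g_pos S0g]]] :=
    section_without_ray C0 CD CZ f0_pos affH0 S0E (has_dim_nonempty dimS0).
- by move=> y z Cz; exact: ellipsoid_no_ray.
(* A section reduced to 0 has dimension 0, so [C] has dimension 1. *)
- apply: CSS_dim1; rewrite S00 in dimS0.
  by have := has_dim_uniq dimS0 (has_dim_set1 0) => d00; rewrite d00 in dimC.
move=> S [H [d [affH SE _ dimS]]] bS.
have [|S_eq0|[h [h_pos Sh]]] :=
    section_without_ray C0 CD CZ f0_pos affH SE (has_dim_nonempty dimS).
- by move=> y z _; exact: bounded_no_ray.
- exists 0; rewrite S_eq0; apply/seteqP; split=> y.
    by move=> ->; exists 0 => //; rewrite mul0rn subrr.
  by move=> [_ -> <-]; rewrite /= mul0rn subrr.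
case: ellS0 => E [ip [f [p S0f]]]; rewrite S0g in S0f.
have [c [hc symC]] := Lorentz_section_center g_pos h_pos S0f.
have symS x : S x -> S (c *+ 2 - x).
  rewrite Sh => -[Cx /= hx]; rewrite -scaler_nat; split; first exact: symC.
  by rewrite /= !(scalarE h) hc hx; ring.
exists c; apply/seteqP; split=> x => [Sx|[y Sy <-]]; last exact: symS.
by exists (c *+ 2 - x); [exact: symS|rewrite subKr].
Qed.

End Directions.

(** * The case of a line, and the equivalence *)

Lemma line_ellipsoidal (R : realType) (V : vectType R) (C : set V) (y : V) :
  C = [set` <[y]>%VS] -> y != 0 -> ellipsoidal_cone C.
Proof.
move=> CE y0; have Cy : C y by rewrite CE /= memv_line.
have [|f [_ fy]] := @scalar_separation _ _ 0%VS y; first by rewrite memv0.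
have memC x : C x -> x = f x *: y.
  by rewrite CE => /vlineP[t ->]; rewrite scalarZ fy mulr1.
exists (C `&` [set x | f x = 1]); split.
  apply: (@level_is_section _ _ C f y) => //; first by rewrite CE /= mem0v.
  move=> x Cx x0; split; last by rewrite CE /=; apply: memvZ; rewrite CE in Cx.
  by apply: contra x0 => /eqP fx; rewrite (memC x Cx) fx scale0r.
(* The section is the point [y], the image of the unit ball of the zero space. *)
pose L : {linear 'rV[R]_0 -> V} := \0.
exists 'rV[R]_0, (row_dot_form R 0), L, y; apply/seteqP; split=> x.
  move=> [Cx /= fx]; exists 0; first by apply/mem_unit_ball; rewrite ip0r.
  by rewrite /L /= addr0 (memC x Cx) fx scale1r.
by move=> [u _ <-]; rewrite /L /= addr0; split.
Qed.

Lemma has_dim_line (R : realType) (V : vectType R) (y : V) :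
  y != 0 -> has_dim [set` <[y]>%VS] 1.
Proof.
move=> y0; have -> : 1%N = \dim <[y]>%VS by rewrite dim_vline y0.
apply: has_dim_cone => //= [|x]; first exact: mem0v.
move=> xy; exists 1%N, (fun=> 1), (fun=> x); split=> //.
by rewrite big_ord1 scale1r.
Qed.

Theorem theorem1p4 (R : realType) (V : vectType R) (C : set V)
  (coneC : is_cone C) (C_nontrivial : C <> [set 0]) :
  CSS C <-> ellipsoidal_cone C.
Proof.
have [cvxC ptC clC] := coneC; have [C0 CD CZ] := convex_linear_coneP cvxC.
have [y [Cy y0]] : exists y, C y /\ y != 0.
  apply: contra_notP C_nontrivial => ny; apply/seteqP; split=> x => [Cx|->] //.
  by apply/eqP; apply: contra_notT ny => x0; exists x.
have [[f0 f0_pos]|lineC] := pointed_cases Cy y0 CD CZ ptC.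
  split=> [cssC|]; first exact: (CSS_ellipsoidal C0 CD CZ f0_pos clC cssC Cy y0).
  exact: (ellipsoidal_CSS C0 CD CZ f0_pos).
split=> _; first exact: line_ellipsoidal lineC y0.
by apply: CSS_dim1; rewrite lineC; exact: has_dim_line.
Qed.
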